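(* For every $n\ge1$, the map $p\colon\mathfrak{S}_n\to\mathbb{T}_{n+1}$ (the pruned tree map, with pruned trees on $n$ vertices identified with elements of $\mathbb{T}_{n+1}$) gives an order-preserving surjection from $\mathscr{E}_n$ to $\mathscr{C}_{n+1}$.
   Context: Comb poset. $\mathbb{T}_m$ is the set of all full plane binary trees with $m$ leaves (every internal vertex has exactly a left child and a right child); the leaves are labeled $a_1,\ldots,a_m$ from left to right. For $T\in\mathbb{T}_m$, the reduced parenthesization $RP_T$ is the set of all subsets of $\{a_1,\ldots,a_m\}$ which are leaf sets of the subtrees of $T$ rooted at vertices of $T$ and which do not contain $a_m$. The (right) comb poset $\mathscr{C}_m$ is $\mathbb{T}_m$ ordered by $T_1\le T_2$ if and only if $RP_{T_1}\subseteq RP_{T_2}$. Edelman's poset. $\mathscr{E}_n$ is the partial order on the symmetric group $\mathfrak{S}_n$ (permutations in one-line notation) that is the transitive closure of the following covering relation: $\sigma$ covers $\tau$ if $\sigma$ is obtained from $\tau$ by transposing two adjacent entries $\tau(j)<\tau(j+1)$, and, after the transposition, nothing to the left of $\tau(j+1)$ in $\sigma$ is greater than $\tau(j+1)$. Pruned tree map. Deleting the leaves of a full binary tree (''pruning'') is a bijection from $\mathbb{T}_{n+1}$ to (possibly incomplete) plane binary trees with $n$ vertices (each vertex has at most one left and at most one right child), called pruned trees. The map $p$ from $\mathfrak{S}_n$ to pruned trees on $n$ vertices is defined recursively on sequences of distinct numbers: for a one-element sequence, $p(x)$ is a single vertex (and the empty sequence gives the empty tree); for $x=(x_1,\ldots,x_n)$,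 $p(x)$ is the tree whose root has left subtree $p(x_<)$ and right subtree $p(x_>)$, where $x_<$ (resp. $x_>$) is the subsequence of the entries of $x$ that are less than (resp. greater than) $x_1$, in the same order as in $x$. Via unpruning, $p(x)$ is regarded as an element of $\mathbb{T}_{n+1}$. *)

(* Defs.v *)
From mathcomp Require Import all_boot all_fingroup.

Set Implicit Arguments.
Unset Strict Implicit.
Unset Printing Implicit Defensive.

Inductive ftree : Type := Leaf | Node of ftree & ftree.

Fixpoint nleaves (t : ftree) : nat :=
  if t is Node l r then nleaves l + nleaves r else 1.

Definition fulltree (m : nat) : Type := {t : ftree | nleaves t == m}.

(* The leaves of [t] from left to right, numbered consecutively from [k]. *)
Fixpoint leaf_labels (k : nat) (t : ftree) : seq nat :=
  if t is Node l r then leaf_labels k l ++ leaf_labels (k + nleaves l) r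
  else [:: k].

(* One entry per vertex of [t]: the labels of the leaves below that vertex. *)
Fixpoint subtree_labels (k : nat) (t : ftree) : seq (seq nat) :=
  leaf_labels k t ::
  (if t is Node l r then
     subtree_labels k l ++ subtree_labels (k + nleaves l) r
   else [::]).

(* The leaf a_(i+1) is represented by i : 'I_m, so that a_m is the i with
   i.+1 = m. *)
Definition reduced_paren (m : nat) (T : fulltree m) : {set {set 'I_m}} :=
  [set A : {set 'I_m} |
    (A \in [seq [set i : 'I_m | val i \in s] | s <- subtree_labels 0 (val T)])
    && [forall i in A, i.+1 != m]].

Definition comb_le (m : nat) (T1 T2 : fulltree m) : bool :=
  reduced_paren T1 \subset reduced_paren T2.

(* A permutation s of 'I_n has one-line notation s 0, s 1, ..., s n.-1: both
   positions and entries are shifted down by one. *)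
Definition one_line (n : nat) (s : 'S_n) : seq nat :=
  [seq val (s i) | i <- enum 'I_n].

(* [edelman_cover t s] says that s covers t.  As (u * t) i = t (u i) for
   permutations, tperm j j' * t exchanges the entries of t in positions j and
   j'; the entry t j' is then in position j of s. *)
Definition edelman_cover (n : nat) (t s : 'S_n) : bool :=
  [exists j : 'I_n, exists j' : 'I_n,
    [&& j' == j.+1 :> nat,
        t j < t j',
        s == (tperm j j' * t)%g
      & [forall i : 'I_n, (i < j) ==> ~~ (t j' < s i)]]].

Definition edelman_le (n : nat) (t s : 'S_n) : bool :=
  connect (@edelman_cover n) t s.

(* Possibly incomplete plane binary trees; [Empty] is an absent child. *)
Inductive ptree : Type := Empty | Vertex of ptree & ptree.

Fixpoint nvertices (t : ptree) : nat :=
  if t is Vertex l r then (nvertices l + nvertices r).+1 else 0.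

Fixpoint prune (t : ftree) : ptree :=
  if t is Node l r then Vertex (prune l) (prune r) else Empty.

Fixpoint unprune (t : ptree) : ftree :=
  if t is Vertex l r then Node (unprune l) (unprune r) else Leaf.

Lemma pruneK : cancel prune unprune.
Proof. by elim=> //= l -> r ->. Qed.

Lemma unpruneK : cancel unprune prune.
Proof. by elim=> //= l -> r ->. Qed.

Lemma nleaves_unprune (t : ptree) : nleaves (unprune t) = (nvertices t).+1.
Proof. by elim: t => //= l -> r ->; rewrite addSn addnS. Qed.

(* [k] bounds the recursion depth; the intended recursion is
   [pruned_seq_cons]. *)
Fixpoint pruned_rec (k : nat) (s : seq nat) : ptree :=
  match k, s with
  | k'.+1, x :: s' => Vertex (pruned_rec k' [seq y <- s' | y < x])
                             (pruned_rec k' [seq y <- s' | x < y])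
  | _, _ => Empty
  end.

Definition pruned_seq (s : seq nat) : ptree := pruned_rec (size s) s.

Lemma pruned_rec_size (k : nat) (s : seq nat) :
  size s <= k -> pruned_rec k s = pruned_seq s.
Proof.
elim: k {-2}k (leqnn k) s => [|m IHm] [|k] // lekm [|x s] //= lesk.
have szf (a : pred nat) : size (filter a s) <= size s.
  by rewrite size_filter count_size.
have lesm : size s <= m := leq_trans lesk lekm.
by rewrite /pruned_seq /= !(IHm k) ?(IHm (size s)) ?(leq_trans (szf _)).
Qed.

Lemma pruned_seq_cons (x : nat) (s : seq nat) :
  pruned_seq (x :: s) =
  Vertex (pruned_seq [seq y <- s | y < x]) (pruned_seq [seq y <- s | x < y]).
Proof.
by rewrite {1}/pruned_seq /= !pruned_rec_size // size_filter count_size.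
Qed.

Lemma nvertices_pruned_seq (s : seq nat) :
  uniq s -> nvertices (pruned_seq s) = size s.
Proof.
have [m] := ubnP (size s); elim: m s => [|m IHm] [|x s] // lesm.
rewrite pruned_seq_cons => /= /andP[xs us].
have szf (a : pred nat) : size (filter a s) < m.
  by rewrite size_filter (leq_ltn_trans (count_size _ _)).
rewrite !IHm ?filter_uniq // !size_filter -(count_predC (ltn^~ x) s).
congr (_ + _).+1; apply: eq_in_count => y ys /=.
by rewrite -leqNgt ltn_neqAle; case: eqVneq xs => // ->; rewrite ys.
Qed.

Lemma nleaves_pruned (n : nat) (s : 'S_n) :
  nleaves (unprune (pruned_seq (one_line s))) == n.+1.
Proof.
rewrite nleaves_unprune nvertices_pruned_seq.
  by rewrite size_map size_enum_ord.
by rewrite map_inj_uniq ?enum_uniq // => i j /val_inj /perm_inj.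
Qed.

Definition pruned_map (n : nat) (s : 'S_n) : fulltree n.+1 :=
  exist _ (unprune (pruned_seq (one_line s))) (nleaves_pruned s).

(* Main.v *)
(** A permutation is read as the order in which keys are inserted in a binary
    search tree, leaf number [i] lying between the keys [i - 1] and [i].  The
    leaves [i .. j] form a subtree exactly when every key of [i .. j - 1] is
    inserted after the keys [i - 1] and [j], whenever these exist.  An Edelman
    cover only changes the relative order of two keys [a < b] inserted in
    succession, so it can only destroy a subtree with [i - 1 = a] and [b < j];
    then [j] is inserted before [b], hence before [a], contradicting that all
    earlier keys are smaller than [b].  A tree is the image of its preorder
    reading. *)

Require Import Defs.
From mathcomp Require Import all_boot all_fingroup.
From mathcomp Require Import zify.

(** * Subtrees of a search tree as intervals of leaves *)

Lemma leaf_labelsE (k : nat) (t : ftree) : leaf_labels k t = iota k (nleaves t).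
Proof. by elim: t k => //= l IHl r IHr k; rewrite IHl IHr -iotaD. Qed.

(* The keys are [lo .. hi - 1], inserted in increasing order of [pos]. *)
Definition subtree_interval (pos : nat -> nat) (lo hi i j : nat) : Prop :=
  [/\ lo <= i, i <= j, j <= hi &
    forall x, i <= x < j ->
      (lo < i -> pos i.-1 < pos x) /\ (j < hi -> pos j < pos x)].

(** The recursive description of intervals at the root key [x], the first one inserted. If
    [i <= x < j], no key can precede [x], so the interval has no neighbouring key and is everything.
    Otherwise it lies on one side of [x]; there [x] takes the place of the bound [hi] or [lo], and
    if it is a neighbour its condition holds by minimality. *)
Lemma subtree_intervalP (pos : nat -> nat) (lo hi x i j : nat) :
  lo <= x < hi -> (forall y, lo <= y < hi -> y != x -> pos x < pos y) ->
  subtree_interval pos lo hi i j <->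
  [\/ i = lo /\ j = hi, subtree_interval pos lo x i j
    | subtree_interval pos x.+1 hi i j].
Proof.
move=> xlh xmin; split.
- case=> loi ij jhi after.
  case: (leqP j x) => [jx|xj].
    constructor 2; split=> // y yij; have [yl yr] := after y yij.
    by split=> // jltx; apply: yr; lia.
  case: (leqP i x) => [ix|xi]; last first.
    constructor 3; split=> // y yij; have [yl yr] := after y yij.
    by split=> // jltx; apply: yl; lia.
  constructor 1; have [xl xr] : (lo < i -> pos i.-1 < pos x) /\
    (j < hi -> pos j < pos x) by apply: after; lia.
  split; apply/eqP; rewrite eqn_leq; apply/andP; split=> //.
    rewrite leqNgt; apply/negP => loi'; have := xl loi'.
    by rewrite ltnNge ltnW //; apply: xmin; lia.
  rewrite leqNgt; apply/negP => jhi'; have := xr jhi'.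
  by rewrite ltnNge ltnW //; apply: xmin; lia.
- case=> [[-> ->]|[loi ij jx after]|[xi ij jhi after]].
  + by split=> [|||y _]; rewrite ?ltnn //; lia.
  + split=> //; first lia; move=> y yij; have [yl yr] := after y yij.
    split=> // _; have [/yr //|xj] := ltnP j x.
    have -> : j = x by lia.
    by apply: xmin; lia.
  + split=> //; first lia; move=> y yij; have [yl yr] := after y yij.
    split=> // _; have [/yl //|ix] := ltnP x.+1 i.
    have -> : i.-1 = x by lia.
    by apply: xmin; lia.
Qed.

(** Induction on the length of [s], matching the root and its two subtrees with the three cases of
    [subtree_intervalP]. The function [pos] stays abstract so that the same one serves all filtered
    subsequences. *)
Lemma subtree_labelsP (pos : nat -> nat) (lo hi : nat) (s A : seq nat) :
  lo <= hi -> (forall z, (z \in s) = (lo <= z < hi)) ->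
  sorted (relpre pos ltn) s ->
  A \in subtree_labels lo (unprune (pruned_seq s)) <->
  exists i j, subtree_interval pos lo hi i j /\ A = iota i (j.+1 - i).
Proof.
have [m] := ubnP (size s); elim: m s lo hi A => // m IHm s lo hi A lesm lohi.
have pos_tr : transitive (relpre pos ltn) by move=> y x z; apply: ltn_trans.
have pos_irr : irreflexive (relpre pos ltn) by move=> x; apply: ltnn.
case: s lesm => [|x s] lesm smem ssorted.
  have -> : hi = lo by apply/eqP; have := smem lo; rewrite in_nil; lia.
  rewrite /= inE; split=> [/eqP ->|[i [j [[loi ij jlo _] ->]]]].
    exists lo, lo; rewrite subSnn; split=> //; split=> // x; lia.
  have [-> ->] : i = lo /\ j = lo by lia.
  by rewrite subSnn.
have xlh : lo <= x < hi by rewrite -smem mem_head.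
have xmin y : lo <= y < hi -> y != x -> pos x < pos y.
  rewrite -smem inE => /predU1P[->|ys _]; first by rewrite eqxx.
  by have /allP/(_ y ys) := order_path_min pos_tr ssorted.
have us : uniq (x :: s) := sorted_uniq pos_tr pos_irr ssorted.
have s_sorted := path_sorted ssorted.
have smem' z : (z \in s) = (lo <= z < hi) && (z != x).
  rewrite -smem inE; case: eqVneq => [->|] //=; last by rewrite andbT.
  by case/andP: us => /negbTE.
have szf (a : pred nat) : size (filter a s) < m.
  by rewrite size_filter (leq_ltn_trans (count_size _ _)).
have IHl B := IHm [seq y <- s | y < x] lo x B (szf _).
have IHr B := IHm [seq y <- s | x < y] x.+1 hi B (szf _).
have szl : size [seq y <- s | y < x] = x - lo.
  rewrite -(size_iota lo (x - lo)); apply/perm_size/uniq_perm.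
  - by case/andP: us => _; apply: filter_uniq.
  - exact: iota_uniq.
  by move=> z; rewrite mem_filter smem' mem_iota; lia.
have szs : size s = (hi - lo).-1.
  rewrite -[size s]/(size (x :: s)).-1 -(size_iota lo (hi - lo)); congr _.-1.
  apply/perm_size/uniq_perm=> //; first exact: iota_uniq.
  by move=> z; rewrite smem mem_iota; lia.
have eqlab : leaf_labels lo (unprune (pruned_seq (x :: s))) =
             iota lo (hi.+1 - lo).
  rewrite leaf_labelsE nleaves_unprune nvertices_pruned_seq // [size _]/= szs.
  by congr (iota _ _); lia.
(* The left subtree has [x - lo] keys, hence one more leaf, so the labels of the right subtree start
   at [x.+1]. *)
have -> : subtree_labels lo (unprune (pruned_seq (x :: s))) =
  iota lo (hi.+1 - lo) ::
    subtree_labels lo (unprune (pruned_seq [seq y <- s | y < x])) ++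
    subtree_labels x.+1 (unprune (pruned_seq [seq y <- s | x < y])).
  rewrite -eqlab pruned_seq_cons /= nleaves_unprune.
  rewrite nvertices_pruned_seq ?szl ?addnS ?subnKC //; first lia.
  by case/andP: us => _; apply: filter_uniq.
have {IHl} IHl B : B \in subtree_labels lo (unprune (pruned_seq
    [seq y <- s | y < x])) <-> exists i j,
    subtree_interval pos lo x i j /\ B = iota i (j.+1 - i).
  apply: IHl; [lia| |exact: sorted_filter].
  by move=> z; rewrite mem_filter smem'; lia.
have {IHr} IHr B : B \in subtree_labels x.+1 (unprune (pruned_seq
    [seq y <- s | x < y])) <-> exists i j,
    subtree_interval pos x.+1 hi i j /\ B = iota i (j.+1 - i).
  apply: IHr; [lia| |exact: sorted_filter].
  by move=> z; rewrite mem_filter smem'; lia.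
rewrite inE mem_cat; split.
- case/or3P => [/eqP ->|/IHl[i [j [ij ->]]]|/IHr[i [j [ij ->]]]].
  + exists lo, hi; split=> //.
    by apply/(subtree_intervalP _ _ _ _ _ _ xlh xmin); constructor 1.
  + exists i, j; split=> //.
    by apply/(subtree_intervalP _ _ _ _ _ _ xlh xmin); constructor 2.
  + exists i, j; split=> //.
    by apply/(subtree_intervalP _ _ _ _ _ _ xlh xmin); constructor 3.
- case=> i [j [/(subtree_intervalP _ _ _ _ _ _ xlh xmin) ij ->]].
  apply/or3P; case: ij => [[-> ->]|ij|ij]; first by constructor 1.
    by constructor 2; apply/IHl; exists i, j.
  by constructor 3; apply/IHr; exists i, j.
Qed.

(** * Order preservation *)

(** The inverse permutation, extended to all naturals so that it can serve as [pos]. *)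
Definition position {n : nat} (s : 'S_n) (x : nat) : nat := index x (one_line s).

Lemma size_one_line {n : nat} (s : 'S_n) : size (one_line s) = n.
Proof. by rewrite size_map size_enum_ord. Qed.

Lemma one_line_uniq {n : nat} (s : 'S_n) : uniq (one_line s).
Proof.
by rewrite map_inj_uniq ?enum_uniq // => i j /val_inj /perm_inj.
Qed.

Lemma mem_one_line {n : nat} (s : 'S_n) (x : nat) : (x \in one_line s) = (x < n).
Proof.
apply/mapP/idP => [[i _ ->]|xn]; first exact: ltn_ord.
by exists (s^-1%g (Ordinal xn)); rewrite ?mem_enum ?permKV.
Qed.

Lemma nth_one_line {n : nat} (s : 'S_n) (i : 'I_n) (x0 : nat) :
  nth x0 (one_line s) i = s i.
Proof. by rewrite (nth_map i) ?size_enum_ord // nth_ord_enum. Qed.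

Lemma position_perm {n : nat} (s : 'S_n) (i : 'I_n) : position s (s i) = i.
Proof.
rewrite /position -(nth_one_line s i 0).
by rewrite index_uniq ?size_one_line ?one_line_uniq.
Qed.

Lemma sorted_index (T : eqType) (s : seq T) :
  uniq s -> sorted (relpre (index^~ s) ltn) s.
Proof.
case: s => // x0 s'; move: (x0 :: s') => s us; apply/(sortedP x0) => i ilt.
by rewrite /= !index_uniq // ltnW.
Qed.

(** Leaf [n] is the last one, so leaving it out amounts to [j < n]; the key [j] bounding the
    interval on the right then exists. *)
Lemma reduced_paren_pruned_map {n : nat} (s : 'S_n) (A : {set 'I_n.+1}) :
  A \in reduced_paren (pruned_map s) <->
  exists i j, [/\ subtree_interval (position s) 0 n i j, j < n &
                  A = [set k : 'I_n.+1 | i <= k <= j]].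
Proof.
have labP B := subtree_labelsP (position s) 0 n (one_line s) B (leq0n n)
  (mem_one_line s) (sorted_index _ _ (one_line_uniq s)).
rewrite inE; split.
- case/andP => /mapP[B /labP[i [j [ij ->]]] ->] /forallP jlt.
  case: (ij) => _ leij lejn _.
  exists i, j; split=> //; last by apply/setP=> k; rewrite !inE mem_iota /=; lia.
  have := jlt (inord j); rewrite inE /= mem_iota inordK //; lia.
- case=> i [j [ij jn ->]]; case: (ij) => _ leij _ _.
  apply/andP; split; last by apply/forallP=> k; rewrite inE; lia.
  apply/mapP; exists (iota i (j.+1 - i)); first by apply/labP; exists i, j.
  by apply/setP=> k; rewrite !inE mem_iota /=; lia.
Qed.

Lemma edelman_cover_comb_le {n : nat} (t s : 'S_n) :
  edelman_cover t s -> comb_le (pruned_map t) (pruned_map s).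
Proof.
case/existsP=> p /existsP[p' /and4P[/eqP p'E ab /eqP sE /forallP below]].
have posE (k : 'I_n) : position s (t k) = tperm p p' k.
  by rewrite -[in RHS](position_perm s) sE permM tpermK.
have below' (k : 'I_n) : k < p -> t k <= t p'.
  move=> kp; have /implyP/(_ kp) := below k; rewrite -leqNgt sE permM tpermD //.
    by apply/eqP=> E; move: kp; rewrite -E ltnn.
  by apply/eqP=> E; move: kp; rewrite -E p'E; lia.
(* Exchanging two adjacent positions reverses the relative order of the two exchanged entries
   only. *)
have swap (y x : nat) : y < n -> x < n ->
    position t y < position t x ->
    position s y < position s x \/ y = t p /\ x = t p'.
  move=> yn xn.
  have [ky <-] : exists k, val (t k) = y.
    by exists (t^-1%g (Ordinal yn)); rewrite permKV.
  have [kx <-] : exists k, val (t k) = x.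
    by exists (t^-1%g (Ordinal xn)); rewrite permKV.
  rewrite !posE !position_perm.
  do 2![case: tpermP => [->|->|/eqP + /eqP]];
    rewrite -?(inj_eq val_inj) /= ?p'E; lia.
apply/subsetP=> A /reduced_paren_pruned_map[i [j [[_ ij jn after] jltn ->]]].
apply/reduced_paren_pruned_map; exists i, j; split=> //; split=> // x xij.
have [xl xr] := after x xij.
split=> [i0|_].
  have [||//|[iE xE]] := swap _ _ _ _ (xl i0); [lia|lia|].
  (* Here [i.-1 = t p] and [x = t p']. In [t], the key [j] comes before [x], and it is not [t p]
     since [i.-1 < j]; so it sits left of [p], and [below'] gives [j <= x], against [x < j]. *)
  have jE : val (t (t^-1%g (Ordinal jltn))) = j by rewrite permKV.
  have := xr jltn; rewrite xE -{1}jE !position_perm => jp'.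
  have jp : t^-1%g (Ordinal jltn) != p.
    by apply/eqP=> E; move: jE; rewrite E /=; lia.
  have := below' (t^-1%g (Ordinal jltn)); rewrite jE.
  rewrite -(inj_eq val_inj) /= in jp; lia.
(* A reversed pair would have [j = t p < t p' = x], against [x < j]. *)
have [||//|[jE xE]] := swap _ _ _ _ (xr jltn); lia.
Qed.

(** * Surjectivity *)

(** The vertices carry their inorder numbers counted from [k], as in a search tree, and are listed
    root first. *)
Fixpoint preorder (k : nat) (t : ptree) : seq nat :=
  if t is Vertex l r then
    (k + nvertices l) :: preorder k l ++ preorder (k + nvertices l).+1 r
  else [::].

Lemma perm_preorder (k : nat) (t : ptree) :
  perm_eq (preorder k t) (iota k (nvertices t)).
Proof.
elim: t k => // l IHl r IHr k.
have -> : iota k (nvertices (Vertex l r)) = iota k (nvertices l) ++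
    [:: k + nvertices l] ++ iota (k + nvertices l).+1 (nvertices r).
  by rewrite [nvertices _]/= -addnS iotaD.
by rewrite perm_sym perm_catCA perm_cons perm_sym perm_cat.
Qed.

(** Inorder numbers in [l] are below the root's and those in [r] above it, so the two filters
    recover the readings of [l] and [r]. *)
Lemma pruned_preorder (k : nat) (t : ptree) : pruned_seq (preorder k t) = t.
Proof.
elim: t k => //= l IHl r IHr k; rewrite pruned_seq_cons !filter_cat.
have lP z : z \in preorder k l -> k <= z < k + nvertices l.
  by rewrite (perm_mem (perm_preorder k l)) mem_iota.
have rP z : z \in preorder (k + nvertices l).+1 r -> k + nvertices l < z.
  by rewrite (perm_mem (perm_preorder _ r)) mem_iota => /andP[].
congr Vertex.
- rewrite -[RHS](IHl k); congr pruned_seq; rewrite -[RHS]cats0; congr (_ ++ _).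
    by apply/all_filterP/allP=> z /lP; lia.
  by apply/eqP; rewrite -size_eq0 size_filter -leqn0 leqNgt -has_count;
     apply/hasPn=> z /rP; lia.
- rewrite -[RHS](IHr (k + nvertices l).+1); congr pruned_seq.
  rewrite -[RHS]cat0s; congr (_ ++ _).
    by apply/eqP; rewrite -size_eq0 size_filter -leqn0 leqNgt -has_count;
       apply/hasPn=> z /lP; lia.
  by apply/all_filterP/allP=> z /rP; lia.
Qed.

Lemma one_line_surj (n : nat) (w : seq nat) :
  perm_eq w (iota 0 n) -> exists s : 'S_n, one_line s = w.
Proof.
move=> wp; have wsz : size w = n by rewrite (perm_size wp) size_iota.
have wlt (i : 'I_n) : nth 0 w i < n.
  have : nth 0 w i \in w by rewrite mem_nth ?wsz.
  by rewrite (perm_mem wp) mem_iota.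
have f_inj : injective (fun i : 'I_n => Ordinal (wlt i)).
  move=> i j /(congr1 val) /= /eqP.
  by rewrite nth_uniq ?wsz ?(perm_uniq wp) ?iota_uniq // => /eqP/val_inj.
exists (perm f_inj); apply: (@eq_from_nth _ 0); rewrite size_one_line ?wsz //.
by move=> i lt_in; rewrite (nth_one_line _ (Ordinal lt_in)) permE.
Qed.

Lemma nvertices_prune (t : ftree) : (nvertices (prune t)).+1 = nleaves t.
Proof. by rewrite -nleaves_unprune pruneK. Qed.

Lemma pruned_map_surj (n : nat) (T : fulltree n.+1) :
  exists s : 'S_n, pruned_map s = T.
Proof.
case: T => t tn; have tE : nvertices (prune t) = n.
  by apply/eqP; rewrite -eqSS nvertices_prune.
have [|s sE] := one_line_surj n (preorder 0 (prune t)).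
  by rewrite -tE perm_preorder.
exists s; rewrite /pruned_map; move: (nleaves_pruned s).
rewrite sE pruned_preorder pruneK => tn'; congr exist; exact: bool_irrelevance.
Qed.

Theorem theorem6p3 (n : nat) (hn : 1 <= n) :
  (forall t s : 'S_n, edelman_le t s -> comb_le (pruned_map t) (pruned_map s))
  /\ (forall T : fulltree n.+1, exists s : 'S_n, pruned_map s = T).
Proof.
split=> [t s /connectP[c]|T]; last exact: pruned_map_surj.
elim: c t => [|u c IHc] t /=; first by move=> _ ->; apply: subxx.
case/andP=> tu uc sE; exact: subset_trans (edelman_cover_comb_le _ _ tu) (IHc u uc sE).
Qed.
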